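(* Let $\mathcal{A} \in \mathbb{R}^{n \times n \times p}$ be T-positive definite with Fourier slices $\hat{A}^{(i)}$, $i = 1, \ldots, p$. Denote the eigenvalues of $\hat{A}^{(i)}$ by $\lambda_j^{(i)} > 0$ ($j=1,\dots,n$), and define $\lambda_{\min} := \min_{i,j} \lambda_j^{(i)}$ and $\lambda_{\max} := \max_{i,j} \lambda_j^{(i)}$. Consider the Newton iteration $$\mathcal{X}_{k+1} = \frac{1}{2}\bigl(\mathcal{X}_k + \mathcal{X}_k^{-1} * \mathcal{A}\bigr), \qquad k = 0, 1, 2, \ldots,$$ implemented in the Fourier domain with initialization $\hat{X}_0^{(i)} = \hat{A}^{(i)}$ for each $i = 1, \ldots, p$ (that is, $\mathcal{X}_0 = \mathcal{A}$), where $\hat{X}_k^{(i)}$ denotes the $i$-th Fourier slice of $\mathcal{X}_k$. Then: (a) (Well-definedness) All iterates $\mathcal{X}_k$ are T-positive definite and hence T-invertible. (b) (Global convergence) The sequence $\{\mathcal{X}_k\}$ converges to $\mathcal{A}^{1/2}$ in the tensor Frobenius norm. (c) (Quadratic convergence) There exists a constant $C > 0$ depending on $\lambda_{\min}$ and $\lambda_{\max}$ such that $$\|\mathcal{X}_{k+1} - \mathcal{A}^{1/2}\|_F \leq C\, \|\mathcal{X}_k - \mathcal{A}^{1/2}\|_F^2$$ for all $k \geq 0$.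
   Context: For a third-order tensor $\mathcal{A} \in \mathbb{R}^{n \times m \times p}$, its frontal slices are the matrices $A^{(k)} = \mathcal{A}(:,:,k) \in \mathbb{R}^{n\times m}$, $k=1,\dots,p$. T-product: for $\mathcal{A},\mathcal{B} \in \mathbb{R}^{n\times n\times p}$, $\mathcal{A} * \mathcal{B} = \mathrm{fold}(\mathrm{bcirc}(\mathcal{A}) \cdot \mathrm{unfold}(\mathcal{B}))$, where $\mathrm{unfold}(\mathcal{B}) \in \mathbb{R}^{np \times n}$ stacks the frontal slices $B^{(1)},\dots,B^{(p)}$ vertically, $\mathrm{fold}$ is its inverse, and $\mathrm{bcirc}(\mathcal{A}) \in \mathbb{R}^{np\times np}$ is the block-circulant matrix whose first block column is $A^{(1)},\dots,A^{(p)}$. The identity tensor $\mathcal{I}$ has first frontal slice $I_n$ and all other frontal slices zero. $\mathcal{X}$ is T-invertible if there is a tensor $\mathcal{X}^{-1}$ with $\mathcal{X} * \mathcal{X}^{-1} = \mathcal{X}^{-1} * \mathcal{X} = \mathcal{I}$; $\mathcal{X}^{-1}$ is its T-product inverse. Fourier slices: $\hat{\mathcal{A}} = \mathrm{fft}(\mathcal{A}, \text{axis}=3)$ is the discrete Fourier transform of $\mathcal{A}$ along the third mode, with frontal slices $\hat{A}^{(i)} = \sum_{k=1}^p e^{-2\pi \mathrm{i}(i-1)(k-1)/p} A^{(k)}$, $i=1,\dots,p$. The T-product becomes slice-wise matrix multiplication: if $\mathcal{C} = \mathcal{A}*\mathcal{B}$ then $\hat{C}^{(i)} = \hat{A}^{(i)}\hat{B}^{(i)}$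 for all $i$. $\mathcal{A} \in \mathbb{R}^{n\times n\times p}$ is T-positive definite if every Fourier slice $\hat{A}^{(i)}$, $i=1,\dots,p$, is a Hermitian positive definite matrix. The principal T-square root $\mathcal{A}^{1/2}$ of a T-positive definite $\mathcal{A}$ is the unique T-positive definite tensor in $\mathbb{R}^{n\times n\times p}$ with $\mathcal{A}^{1/2} * \mathcal{A}^{1/2} = \mathcal{A}$; equivalently, its Fourier slices are the principal square roots $(\hat{A}^{(i)})^{1/2}$. The tensor Frobenius norm is $\|\mathcal{A}\|_F = (\sum_{i,j,k} a_{ijk}^2)^{1/2}$. *)

(* Defs.v *)
From HB Require Import structures.
From mathcomp Require Import all_boot all_order all_algebra.
From mathcomp Require Import complex sesquilinear spectral.
From mathcomp Require Import all_classical all_reals all_analysis.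

Set Implicit Arguments.
Unset Strict Implicit.
Unset Printing Implicit Defensive.

Import Order.TTheory GRing.Theory Num.Theory.
Import numFieldNormedType.Exports.

Local Open Scope classical_set_scope.
Local Open Scope complex_scope.
Local Open Scope sesquilinear_scope.
Local Open Scope ring_scope.

(* A third-order tensor in R^(n x n x p), given by its frontal slices,
   numbered from 0: [A k] is the slice written A^(k+1). *)
Notation tensor R n p := {ffun 'I_p -> 'M[R]_n}.

Section TProduct.
Variables (R : realType) (n p : nat).
Implicit Types A B X Y : tensor R n p.+1.

Definition unfold B : 'M[R]_(\sum_(i < p.+1) n, n) :=
  \mxcol_(i < p.+1) B i.

Definition fold (M : 'M[R]_(\sum_(i < p.+1) n, n)) : tensor R n p.+1 :=
  [ffun i => submxcol M i].

(* The difference [i - j] is taken in 'I_p.+1, i.e. modulo p.+1. *)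
Definition bcirc A : 'M[R]_(\sum_(i < p.+1) n, \sum_(i < p.+1) n) :=
  \mxblock_(i < p.+1, j < p.+1) A (i - j).

Definition tprod A B : tensor R n p.+1 := fold (bcirc A *m unfold B).

Definition tid : tensor R n p.+1 := [ffun k => if k == 0 then 1%:M else 0].

Definition is_tinv X Y := tprod X Y = tid /\ tprod Y X = tid.

Definition tinvertible X := exists Y, is_tinv X Y.

(* Equal to the zero tensor when X is not T-invertible. *)
Definition tinv X : tensor R n p.+1 := xget 0 [set Y | is_tinv X Y].

Definition tfnorm A : R :=
  Num.sqrt (\sum_(k < p.+1) \sum_(i < n) \sum_(j < n) A k i j ^+ 2).

End TProduct.

Arguments tid {R n p}.

Section Fourier.
Variables (R : realType) (n p : nat).
Implicit Types A S : tensor R n p.+1.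

(* exp (- 2 pi i a / q) *)
Definition dft_root (q a : nat) : R[i] :=
  let t := 2 * pi * a%:R / q%:R : R in cos t -i* sin t.

Definition fslice A (i : 'I_p.+1) : 'M[R[i]]_n :=
  \sum_(k < p.+1) dft_root p.+1 (i * k) *: map_mx (real_complex R) (A k).

(* [z > 0] in R[i] means that z is real and positive. *)
Definition hermposdef (M : 'M[R[i]]_n) :=
  M \is hermsymmx /\
  forall v : 'cV[R[i]]_n, v != 0 -> 0 < (v ^t* *m M *m v) 0 0.

Definition tposdef A := forall i : 'I_p.+1, hermposdef (fslice A i).

(* Eigenvalues with multiplicity: the roots of the characteristic polynomial. *)
Definition eigenvalues (M : 'M[R[i]]_n) : seq R[i] :=
  sval (closed_field_poly_normal (char_poly M)).

(* Taking real parts loses nothing on T-positive definite tensors, whose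
   Fourier slices have real eigenvalues. *)
Definition teigenvalues A : seq R :=
  [seq complex.Re l | i <- enum 'I_p.+1, l <- eigenvalues (fslice A i)].

Definition lambda_min A : R :=
  let s := teigenvalues A in \big[Num.min/head 0 s]_(l <- s) l.

Definition lambda_max A : R :=
  let s := teigenvalues A in \big[Num.max/head 0 s]_(l <- s) l.

Definition is_principal_tsqrt A S :=
  [/\ tposdef S, tprod S S = A &
      forall S', tposdef S' -> tprod S' S' = A -> S' = S].

(* Equal to the zero tensor when there is no principal T-square root. *)
Definition tsqrt A : tensor R n p.+1 :=
  xget 0 [set S | is_principal_tsqrt A S].

Fixpoint newton A (k : nat) : tensor R n p.+1 :=
  if k is k'.+1 then
    2^-1 *: (newton A k' + tprod (tinv (newton A k')) A)
  else A.

End Fourier.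

(* Main.v *)
Require Import Defs.
From HB Require Import structures.
From mathcomp Require Import all_boot all_order all_algebra.
From mathcomp Require Import complex sesquilinear spectral.
From mathcomp Require Import all_classical all_reals all_analysis.
From mathcomp Require Import ring.

Set Implicit Arguments.
Unset Strict Implicit.
Unset Printing Implicit Defensive.

Import Order.TTheory GRing.Theory Num.Theory.
Import numFieldNormedType.Exports.

Local Open Scope classical_set_scope.
Local Open Scope ring_scope.

(** The Fourier transform turns the T-product into slice-wise matrix
    multiplication ([fslice_tprod]), it is injective ([fslice_inj]), and it
    multiplies squared Frobenius norms by the number [p.+1] of slices
    ([parseval]).  So the iteration can be followed slice by slice, where every
    matrix in sight is diagonal in one fixed orthonormal eigenbasis of the
    Hermitian slice of [A].

    To make this precise, say that a tensor [X] is [f(A)], for a real function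
    [f] of a real variable, when each Fourier slice of [X] is obtained from
    that of [A] by applying [f] to the eigenvalues ([is_tfun]).  Such a tensor
    exists for every [f] ([is_tfun_exists]): a real polynomial interpolating
    [f] on the finitely many eigenvalues, evaluated at [A] in the T-product
    algebra, is one, and it is real without any discussion of the conjugate
    symmetry of its slices.  The map from [f] to [f(A)] respects sums,
    products and inverses, so the [k]-th iterate is [g_k(A)], where [g_k(x)] is
    the [k]-th scalar Newton iterate for the square root of [x] started at [x]
    ([newton_is_tfun]), and the principal square root is [sqrt(A)]
    ([tsqrt_is_tfun]); its uniqueness comes from uniqueness of positive
    definite square roots of matrices ([hermposdef_sqrt_uniq]).

    By Parseval's identity, [p.+1] times the square of the Frobenius norm of
    [f(A)] is the sum of [f(x)^2] over all eigenvalues [x] of all slices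
    ([is_tfun_tfnorm]).  Scalar bounds on the errors [g_k(x) - sqrt x] thus
    carry over to tensors ([is_tfun_tfnorm_le], [is_tfun_tfnorm_sqr_le]), and
    they follow from the scalar identity
    [g_(k+1)(x) - sqrt x = (g_k(x) - sqrt x)^2 / (2 g_k(x))].
    It gives [g_k(x) >= sqrt x] for [k >= 1], hence halving of the errors from
    then on, and [g_k(x) >= m := min(lambda_min, sqrt lambda_min)] for all [k],
    hence quadratic convergence with the constant [sqrt p.+1 / (2 m)]. *)

(** * Roots of unity *)

Section RootsOfUnity.
Variable R : realType.

Lemma dft_rootD q a b :
  dft_root R q (a + b) = dft_root R q a * dft_root R q b.
Proof.
rewrite /dft_root natrD mulrDr mulrDl cosD sinD.
by apply/eqP; rewrite eq_complex /=; apply/andP; split; apply/eqP; ring.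
Qed.

Lemma dft_root0 q : dft_root R q 0 = 1.
Proof. by rewrite /dft_root mulr0 mul0r cos0 sin0 oppr0. Qed.

Lemma dft_rootX q a : dft_root R q a = dft_root R q 1 ^+ a.
Proof.
elim: a => [|a IH]; first by rewrite dft_root0.
by rewrite -addn1 dft_rootD IH addn1 exprSr.
Qed.

Lemma dft_root_order q : (0 < q)%N -> dft_root R q q = 1.
Proof.
move=> q0; rewrite /dft_root mulfK ?pnatr_eq0 -?lt0n//.
by rewrite mulrC mulr_natr cos2pi sin2pi oppr0.
Qed.

Lemma dft_root_neq1 q a : (0 < a < q)%N -> dft_root R q a != 1.
Proof.
move=> /andP[a0 aq]; have q0 := ltn_trans a0 aq.
(* The half angle [u] lies in ]0, pi[ and [1 - cos (2 u) = 2 (sin u)^2]. *)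
pose u : R := pi * a%:R / q%:R.
have u0 : 0 < u by rewrite divr_gt0 ?mulr_gt0 ?pi_gt0 ?ltr0n.
have upi : u < pi.
  by rewrite ltr_pdivrMr ?ltr0n// ltr_pM2l ?pi_gt0// ltr_nat.
have su : 0 < sin u by apply: sin_gt0_pi; rewrite u0.
rewrite /dft_root eq_complex negb_and /=; apply/orP; left.
have -> : 2 * pi * a%:R / q%:R = u *+ 2 :> R.
  by rewrite /u mulr2n; field; rewrite pnatr_eq0 -lt0n.
rewrite cos_mulr2n cos2sin2 -subr_eq0.
have -> : (1 - sin u ^+ 2) *+ 2 - 1 - 1 = - (sin u ^+ 2 *+ 2) by ring.
rewrite oppr_eq0 mulrn_eq0 /=.
by rewrite expf_eq0 /= gt_eqF.
Qed.

Lemma dft_root_prim q : (0 < q)%N -> q.-primitive_root (dft_root R q 1).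
Proof.
move=> q0; apply/andP; split => //; apply/forallP => i.
rewrite unity_rootE -dft_rootX; apply/eqP.
have [->|ne] := eqVneq i.+1 q; first by rewrite dft_root_order// eqxx.
by apply/negbTE/dft_root_neq1; rewrite ltnS leq0n ltn_neqAle ne ltn_ord.
Qed.

Lemma normr_dft_root q a : `|dft_root R q a| = 1.
Proof. by rewrite normc_def /= sqrrN cos2Dsin2 sqrtr1. Qed.

Lemma conj_dft_root q a : (dft_root R q a)^* = (dft_root R q a)^-1.
Proof. by rewrite [RHS]invC_norm normr_dft_root expr1n invr1 mul1r. Qed.

(** Orthogonality of the characters of the cyclic group of order q. *)
Lemma dft_root_orth q (k l : 'I_q) :
  \sum_(i < q) dft_root R q (i * k) * (dft_root R q (i * l))^*
  = (k == l)%:R * q%:R.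
Proof.
have q0 : (0 < q)%N by case: q k {l} => // -[].
have wP := dft_root_prim q0.
set w := dft_root R q 1 in wP *; pose z := w ^+ k / w ^+ l.
have w0 : w != 0 by rewrite -normr_gt0 normr_dft_root.
transitivity (\sum_(i < q) z ^+ i).
  apply: eq_bigr => i _; rewrite conj_dft_root !(dft_rootX q (_ * _)) -/w.
  by rewrite /z exprMn exprVn -!exprM ![(_ * i)%N]mulnC.
have [kl|ne] := eqVneq k l.
  rewrite mul1r /z kl; under eq_bigr do rewrite divff ?expf_neq0// expr1n.
  by rewrite sumr_const card_ord.
(* A geometric sum of ratio [z <> 1] with [z ^+ q = 1] vanishes. *)
have z1 : z - 1 != 0.
  rewrite subr_eq0; apply: contra ne => /eqP z1.
  have : w ^+ k == w ^+ l.
    by rewrite -[w ^+ k](divfK (expf_neq0 l w0)) -/z z1 mul1r.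
  by rewrite (eq_prim_root_expr wP) !modn_small.
apply: (mulfI z1); rewrite -subrX1 mul0r mulr0.
rewrite /z exprMn exprVn -!exprM ![(_ * q)%N]mulnC !exprM (prim_expr_order wP).
by rewrite !expr1n divr1 subrr.
Qed.

End RootsOfUnity.

(** * The Fourier transform and the T-product *)

Section FourierSlices.
Variables (R : realType) (n p : nat).
Implicit Types A B S X Y : tensor R n p.+1.
Local Notation toC := (real_complex R).

Lemma fsliceE A i a b :
  fslice A i a b = \sum_(k < p.+1) dft_root R p.+1 (i * k) * toC (A k a b).
Proof. by rewrite summxE; apply: eq_bigr => k _; rewrite !mxE. Qed.

Lemma fsliceD A B i : fslice (A + B) i = fslice A i + fslice B i.
Proof.
rewrite /fslice -big_split; apply: eq_bigr => k _.
by rewrite ffunE map_mxD scalerDr.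
Qed.

Lemma fsliceZ (c : R) A i : fslice (c *: A) i = toC c *: fslice A i.
Proof.
rewrite /fslice scaler_sumr; apply: eq_bigr => k _.
by rewrite ffunE map_mxZ !scalerA mulrC.
Qed.

Lemma fslice0 i : fslice (0 : tensor R n p.+1) i = 0.
Proof. by rewrite -(scale0r 0) fsliceZ rmorph0 scale0r. Qed.

Lemma fsliceN A i : fslice (- A) i = - fslice A i.
Proof. by rewrite -scaleN1r fsliceZ rmorphN1 scaleN1r. Qed.

Lemma fsliceB A B i : fslice (A - B) i = fslice A i - fslice B i.
Proof. by rewrite fsliceD fsliceN. Qed.

Lemma fslice_sum (I : Type) (r : seq I) (F : I -> tensor R n p.+1) i :
  fslice (\sum_(x <- r) F x) i = \sum_(x <- r) fslice (F x) i.
Proof.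
elim: r => [|x r IHr]; first by rewrite !big_nil fslice0.
by rewrite !big_cons fsliceD IHr.
Qed.

Lemma fslice_tid i : fslice (tid : tensor R n p.+1) i = 1%:M.
Proof.
rewrite /fslice (bigD1 0)//= big1 => [|k kn0].
  by rewrite ffunE eqxx map_mx1 muln0 dft_root0 scale1r addr0.
by rewrite ffunE (negbTE kn0) map_mx0 scaler0.
Qed.

(** The T-product is the cyclic convolution of the sequences of slices. *)
Lemma tprodE A B k : tprod A B k = \sum_j A (k - j) *m B j.
Proof.
rewrite ffunE /unfold /bcirc mxblockEh mul_mxrow_mxcol submxcol_sum.
by apply: eq_bigr => j _; rewrite -submxcol_mul mxcolK.
Qed.

(** Here [k + j] is the sum in ['I_p.+1], that is, modulo [p.+1]. *)
Lemma dft_root_Zp_add (i k j : 'I_p.+1) :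
  dft_root R p.+1 (i * (k + j)%R) =
  dft_root R p.+1 (i * k) * dft_root R p.+1 (i * j).
Proof.
rewrite -dft_rootD -mulnDr !(dft_rootX _ p.+1 (_ * _)).
rewrite -[LHS](prim_expr_mod (dft_root_prim R (ltn0Sn p))).
by rewrite -[RHS](prim_expr_mod (dft_root_prim R (ltn0Sn p))) /= modnMmr.
Qed.

(** The convolution theorem. *)
Lemma fslice_tprod A B i : fslice (tprod A B) i = fslice A i *m fslice B i.
Proof.
rewrite /fslice mulmx_suml.
under [RHS]eq_bigr do rewrite mulmx_sumr.
rewrite exchange_big /=.
under eq_bigr do rewrite tprodE raddf_sum scaler_sumr.
rewrite exchange_big /=; apply: eq_bigr => j _.
rewrite (reindex_inj (addIr j)) /=; apply: eq_bigr => k _.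
by rewrite addrK dft_root_Zp_add map_mxM -scalemxAl -scalemxAr scalerA.
Qed.

Lemma sum_sqr_fslice_entry A a b :
  \sum_i `|fslice A i a b| ^+ 2 = toC (p.+1%:R * \sum_k A k a b ^+ 2).
Proof.
pose w i k := dft_root R p.+1 (i * k).
transitivity (\sum_k \sum_l toC (A k a b) * toC (A l a b) *
    \sum_(i < p.+1) w i k * (w i l)^*).
  under eq_bigr => i _.
    rewrite normCK fsliceE rmorph_sum mulr_suml.
    under eq_bigr do rewrite mulr_sumr.
  over.
  rewrite exchange_big; apply: eq_bigr => k _.
  rewrite exchange_big; apply: eq_bigr => l _.
  rewrite mulr_sumr; apply: eq_bigr => i _ /=.
  rewrite rmorphM /= -/(w i k) -/(w i l).
  have -> : (toC (A l a b))^* = toC (A l a b) by exact: conjc_real.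
  by rewrite mulrACA [RHS]mulrC mulrAC.
rewrite rmorphM rmorph_nat rmorph_sum mulr_sumr; apply: eq_bigr => k _.
rewrite /w (bigD1 k)//= [X in _ + X]big1 => [|l lk].
  by rewrite dft_root_orth eqxx mul1r addr0 rmorphXn mulrC.
by rewrite dft_root_orth eq_sym (negbTE lk) mul0r mulr0.
Qed.

(** Parseval's identity. *)
Lemma parseval A :
  \sum_i \sum_a \sum_b `|fslice A i a b| ^+ 2 = toC (p.+1%:R * tfnorm A ^+ 2).
Proof.
rewrite /tfnorm sqr_sqrtr; last by do 3!apply: sumr_ge0 => ? _; exact: sqr_ge0.
rewrite exchange_big [in RHS]exchange_big mulr_sumr rmorph_sum.
apply: eq_bigr => a _.
rewrite exchange_big [in RHS]exchange_big mulr_sumr rmorph_sum.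
by apply: eq_bigr => b _; rewrite sum_sqr_fslice_entry.
Qed.

Lemma fslice_inj A B : fslice A =1 fslice B -> A = B.
Proof.
move=> eqAB; apply/eqP; rewrite -subr_eq0; apply/eqP.
have : toC (p.+1%:R * tfnorm (A - B) ^+ 2) == 0.
  rewrite -parseval big1// => i _; rewrite big1// => a _; rewrite big1// => b _.
  by rewrite fsliceB eqAB subrr mxE normr0 expr0n.
rewrite fmorph_eq0 mulf_eq0 pnatr_eq0 /= expf_eq0 /= /tfnorm sqrtr_eq0 => le0.
apply/ffunP => k; apply/matrixP => a b.
have -> : (0 : tensor R n p.+1) k a b = 0 by rewrite ffunE mxE.
have sge0 (c : R) : 0 <= c ^+ 2 by exact: sqr_ge0.
apply/eqP; rewrite -sqrf_eq0 eq_le sge0 andbT; apply: le_trans le0.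
rewrite (bigD1 k)//= (bigD1 a)//= (bigD1 b)//= -!addrA lerDl.
by rewrite !addr_ge0 ?sumr_ge0// => *; do ?apply: sumr_ge0 => *.
Qed.

(** A one-sided inverse on each slice is enough, as the slices are square. *)
Lemma is_tinvE X Y :
  is_tinv X Y <-> forall i, fslice X i *m fslice Y i = 1%:M.
Proof.
split=> [[XY _] i|XY]; first by rewrite -fslice_tprod XY fslice_tid.
by split; apply: fslice_inj => i; rewrite fslice_tprod fslice_tid// mulmx1C.
Qed.

Lemma is_tinv_uniq X Y Z : is_tinv X Y -> is_tinv X Z -> Y = Z.
Proof.
move=> /is_tinvE XY /is_tinvE XZ; apply: fslice_inj => i.
by rewrite -[LHS]mulmx1 -(XZ i) mulmxA (mulmx1C (XY i)) mul1mx.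
Qed.

Lemma tinv_eq X Y : is_tinv X Y -> tinv X = Y.
Proof.
move=> XY; apply: (is_tinv_uniq _ XY).
by rewrite /tinv; apply: (xgetPex 0 (ex_intro [set Z | is_tinv X Z] Y XY)).
Qed.

End FourierSlices.

(** * Functions of Hermitian matrices *)

Section HermitianCalculus.
Variables (R : realType) (n : nat).
Implicit Types (M S : 'M[R[i]]_n.+1) (f g : R -> R).
Local Notation toC := (real_complex R).
Local Open Scope sesquilinear_scope.

Lemma adjmxM m1 m2 m3 (X : 'M[R[i]]_(m1, m2)) (Y : 'M[R[i]]_(m2, m3)) :
  (X *m Y)^t* = Y^t* *m X^t*.
Proof. by rewrite trmx_mul map_mxM. Qed.

Lemma adjmxK m1 m2 (X : 'M[R[i]]_(m1, m2)) : (X^t* )^t* = X.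
Proof. by apply/matrixP => a b; rewrite !mxE conjCK. Qed.

Lemma hermsymP M : reflect (M^t* = M) (M \is hermsymmx).
Proof.
apply: (iffP (is_hermitianmxP _ _ _)); rewrite expr0 scale1r.
  by move=> <-.
by move=> ->.
Qed.

(** The [j]-th entry of the spectral diagonalization of [M].  Only the real
    part is kept: nothing is lost when [M] is Hermitian. *)
Definition specval M (j : 'I_n.+1) : R := complex.Re (spectral_diag M 0 j).

(** The matrix which is diagonal, with diagonal [d], in the orthonormal basis
    that diagonalizes [M]. *)
Definition spectral_conj M (d : 'rV[R[i]]_n.+1) : 'M[R[i]]_n.+1 :=
  (spectralmx M)^t* *m diag_mx d *m spectralmx M.

(** The matrix [f(M)], for [M] Hermitian and [f] a real function: same
    eigenvectors as [M], with [f] applied to the eigenvalues. *)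
Definition hfun M f : 'M[R[i]]_n.+1 :=
  spectral_conj M (\row_j toC (f (specval M j))).

Lemma eq_hfun M f g :
  (forall j, f (specval M j) = g (specval M j)) -> hfun M f = hfun M g.
Proof.
move=> fg; congr (spectral_conj M _).
by apply/rowP => j; rewrite !mxE fg.
Qed.

Lemma spectral_mul_adj M : spectralmx M *m (spectralmx M)^t* = 1%:M.
Proof. exact/unitarymxP/spectral_unitarymx. Qed.

Lemma spectral_adj_mul M : (spectralmx M)^t* *m spectralmx M = 1%:M.
Proof. exact/mulmx1C/spectral_mul_adj. Qed.

Lemma spectral_conjM M d e :
  spectral_conj M d *m spectral_conj M e =
  spectral_conj M (\row_j (d 0 j * e 0 j)).
Proof.
have de : diag_mx (\row_j (d 0 j * e 0 j)) = diag_mx d *m diag_mx e.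
  by rewrite mulmx_diag.
rewrite /spectral_conj de !mulmxA.
by rewrite -(mulmxA _ (spectralmx M) (_^t* )) spectral_mul_adj mulmx1.
Qed.

Lemma hfunM M f g : hfun M f *m hfun M g = hfun M (fun x => f x * g x).
Proof.
rewrite spectral_conjM; congr (spectral_conj M _).
by apply/rowP => j; rewrite !mxE rmorphM.
Qed.

Lemma hfun_cst1 M : hfun M (fun=> 1) = 1%:M.
Proof.
rewrite /hfun [X in spectral_conj M X](_ : _ = const_mx 1).
  by rewrite /spectral_conj diag_const_mx mulmx1 spectral_adj_mul.
by apply/rowP => j; rewrite !mxE rmorph1.
Qed.

Lemma hfunD M f g : hfun M (fun x => f x + g x) = hfun M f + hfun M g.
Proof.
rewrite /hfun /spectral_conj -mulmxDl -mulmxDr -raddfD /=.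
congr (spectral_conj M _).
by apply/rowP => j; rewrite !mxE rmorphD.
Qed.

Lemma hfunZ M f (c : R) : hfun M (fun x => c * f x) = toC c *: hfun M f.
Proof.
rewrite /hfun /spectral_conj scalemxAl scalemxAr -linearZ /=.
congr (spectral_conj M _).
by apply/rowP => j; rewrite !mxE rmorphM.
Qed.

Lemma hfun_sum M (I : Type) (r : seq I) (F : I -> R -> R) :
  hfun M (fun x => \sum_(k <- r) F k x) = \sum_(k <- r) hfun M (F k).
Proof.
elim: r => [|k r IHr].
  rewrite big_nil -[RHS](scale0r (hfun M (fun=> 0))).
  rewrite -[0 in RHS](rmorph0 toC) -hfunZ.
  by apply: eq_hfun => j; rewrite big_nil mulr0.
rewrite big_cons -IHr -hfunD; apply: eq_hfun => j.
by rewrite big_cons.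
Qed.

Lemma adj_hfun M f : (hfun M f)^t* = hfun M f.
Proof.
rewrite /hfun /spectral_conj !adjmxM adjmxK tr_diag_mx map_diag_mx mulmxA.
congr (spectral_conj M _); apply/rowP => j; rewrite !mxE.
exact: conjc_real.
Qed.

Lemma hfun_sqrnorm M f :
  \sum_a \sum_b `|hfun M f a b| ^+ 2 = toC (\sum_j f (specval M j) ^+ 2).
Proof.
transitivity (\tr (hfun M f *m (hfun M f)^t* )).
  apply: eq_bigr => a _; rewrite !mxE; apply: eq_bigr => b _.
  by rewrite !mxE normCK.
rewrite adj_hfun hfunM /hfun /spectral_conj mxtrace_mulC mulmxA.
rewrite spectral_mul_adj mul1mx.
rewrite mxtrace_diag rmorph_sum; apply: eq_bigr => j _.
by rewrite mxE rmorphXn rmorphM.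
Qed.

(** The quadratic form of [f(M)] is a weighted sum of squared moduli of the
    coordinates in the eigenbasis. *)
Lemma hfun_gt0 M f : (forall j, 0 < f (specval M j)) -> hermposdef (hfun M f).
Proof.
move=> f0; split; first exact/hermsymP/adj_hfun.
move=> v v0; pose u := spectralmx M *m v.
have u0 : u != 0.
  apply: contraNneq v0 => u0; apply/eqP.
  by rewrite -[v]mul1mx -(spectral_adj_mul M) -mulmxA -/u u0 mulmx0.
have -> : v^t* *m hfun M f *m v =
    u^t* *m diag_mx (\row_j toC (f (specval M j))) *m u.
  by rewrite /u adjmxM /hfun /spectral_conj !mulmxA.
move: u u0 => u u0; rewrite mxE.
under eq_bigr do rewrite mul_mx_diag !mxE mulrAC -normCKC.
have t0 j : 0 <= `|u j 0| ^+ 2 * toC (f (specval M j)).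
  by rewrite mulr_ge0 ?exprn_ge0// ler0c ltW.
rewrite lt0r sumr_ge0 ?andbT => [|j _]; last exact: t0.
apply: contraNneq u0 => /eqP.
rewrite psumr_eq0 => [/allP s0|j _]; last exact: t0.
apply/eqP/colP => j; rewrite [RHS]mxE; apply/eqP.
have := s0 j (mem_index_enum j).
rewrite /= mulf_eq0 expf_eq0 /= normr_eq0 fmorph_eq0.
by rewrite [X in _ || X]gt_eqF// orbF.
Qed.

Section PosDef.
Variable M : 'M[R[i]]_n.+1.
Hypothesis Mpd : hermposdef M.

Let U := spectralmx M.

Lemma hermposdef_spectral : M = spectral_conj M (spectral_diag M).
Proof.
have /hermitian_normalmx/orthomx_spectralP := Mpd.1.
by rewrite invmx_unitary ?spectral_unitarymx.
Qed.

(** The diagonal entry is the quadratic form of [M] at the [j]-th vector of the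
    eigenbasis. *)
Lemma spectral_diag_gt0 j : 0 < spectral_diag M 0 j.
Proof.
pose v := col j (U^t* ).
have UU : U *m U^t* = 1%:M := spectral_mul_adj M.
have vE m (X : 'M[R[i]]_(m, n.+1)) : X *m v = col j (X *m U^t* ).
  by rewrite /v !colE mulmxA.
have v0 : v != 0.
  apply/eqP => v0.
  have /(congr1 (fun X : 'cV[R[i]]_n.+1 => X j 0)) : U *m v = 0.
    by rewrite v0 mulmx0.
  by rewrite vE UU !mxE eqxx => /eqP; rewrite oner_eq0.
have MU : M *m U^t* = U^t* *m diag_mx (spectral_diag M).
  have /(congr1 (mulmx^~ (U^t* ))) := hermposdef_spectral.
  by rewrite /= /spectral_conj -mulmxA UU mulmx1.
have := Mpd.2 v v0; rewrite -mulmxA vE MU.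
have -> : v^t* = row j U.
  by rewrite /v tr_col map_row -[in RHS](adjmxK U).
rewrite colE mulmxA -row_mul mulmxA UU mul1mx -colE.
by rewrite !mxE eqxx mulr1n.
Qed.

Lemma specvalE j : spectral_diag M 0 j = toC (specval M j).
Proof.
have := spectral_diag_gt0 j; rewrite /specval.
by case: (spectral_diag M 0 j) => a b; rewrite ltcE /= => /andP[/eqP ->].
Qed.

Lemma specval_gt0 j : 0 < specval M j.
Proof. by have := spectral_diag_gt0 j; rewrite specvalE ltcR. Qed.

Lemma hfun_id : hfun M id = M.
Proof.
rewrite [RHS]hermposdef_spectral; congr (spectral_conj M _).
by apply/rowP => j; rewrite !mxE specvalE.
Qed.

(** Written in the eigenbasis of [M], a matrix [S] commutes with [M] when its
    [(a, b)] entry vanishes unless the [a]-th and [b]-th eigenvalues coincide;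
    the values of [f] at these eigenvalues then coincide as well. *)
Lemma hfun_comm S f : S *m M = M *m S -> S *m hfun M f = hfun M f *m S.
Proof.
move=> SM; pose V := spectralmx M; pose T := V *m S *m V^t*.
have VV : V *m V^t* = 1%:M := spectral_mul_adj M.
have unconj X : X = V^t* *m (V *m X *m V^t* ) *m V.
  by rewrite !mulmxA spectral_adj_mul mul1mx -mulmxA spectral_adj_mul mulmx1.
have conjMr d : V *m (S *m spectral_conj M d) *m V^t* = T *m diag_mx d.
  by rewrite /spectral_conj -/V /T !mulmxA -[LHS]mulmxA VV mulmx1.
have conjMl d : V *m (spectral_conj M d *m S) *m V^t* = diag_mx d *m T.
  by rewrite /spectral_conj -/V /T !mulmxA VV mul1mx.
have TD : T *m diag_mx (spectral_diag M) = diag_mx (spectral_diag M) *m T.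
  by rewrite -conjMr -conjMl -hermposdef_spectral SM.
pose w := \row_j toC (f (specval M j)).
suff Tw : T *m diag_mx w = diag_mx w *m T.
  by rewrite [LHS]unconj /hfun -/w conjMr Tw -conjMl -unconj.
clear unconj conjMr conjMl; clearbody T.
apply/matrixP => a b; move/matrixP/(_ a b): TD.
rewrite !mul_mx_diag !mul_diag_mx !mxE !specvalE.
rewrite [X in _ = X -> _]mulrC => Tab; rewrite [RHS]mulrC; move: Tab.
have [->|Tab] := eqVneq (T a b) 0; first by rewrite !mul0r.
by move=> /(mulfI Tab)/complexI ->.
Qed.

Lemma hermposdef_unit : M \in unitmx.
Proof.
have : M *m hfun M (fun x => x^-1) = 1%:M; last by case/mulmx1_unit.
rewrite -[X in X *m _]hfun_id hfunM -(hfun_cst1 M); apply: eq_hfun => j.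
by rewrite divff ?gt_eqF ?specval_gt0.
Qed.

Lemma mem_eigenvalues l : (l \in eigenvalues M) = eigenvalue M l.
Proof.
rewrite eigenvalue_root_char /eigenvalues.
case: closed_field_poly_normal => r /= ->.
by rewrite (monicP (char_poly_monic M)) scale1r root_prod_XsubC.
Qed.

(** The [j]-th row of [U] is a left eigenvector of [M]. *)
Lemma specval_eigenvalue j : toC (specval M j) \in eigenvalues M.
Proof.
rewrite mem_eigenvalues; apply/eigenvalueP; exists (row j U).
  have UM : U *m M = diag_mx (spectral_diag M) *m U.
    have /(congr1 (mulmx U)) := hermposdef_spectral.
    by rewrite /spectral_conj !mulmxA spectral_mul_adj mul1mx.
  rewrite -row_mul UM row_mul; apply/rowP => k; rewrite mxE.
  rewrite (bigD1 j)//= big1 => [|l lj]; last first.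
    by rewrite !mxE eq_sym (negbTE lj) mulr0n mul0r.
  by rewrite !mxE eqxx mulr1n addr0 specvalE.
apply/eqP => r0.
have /(congr1 (fun X : 'rV_n.+1 => X 0 j)) : row j U *m U^t* = 0.
  by rewrite r0 mul0mx.
by rewrite -row_mul spectral_mul_adj !mxE eqxx => /eqP; rewrite oner_eq0.
Qed.

Lemma eigenvalues_gt0 l : l \in eigenvalues M -> 0 < l.
Proof.
rewrite mem_eigenvalues => /eigenvalueP[u uM u0].
have v0 : u^t* != 0.
  by apply: contraNneq u0 => v0; rewrite -[u]adjmxK v0 trmx0 map_mx0.
have := Mpd.2 _ v0; rewrite adjmxK uM -scalemxAl mxE.
suff u2 : 0 <= (u *m u^t* ) 0 0.
  rewrite le0r in u2; case/orP: u2 => [/eqP ->|u2]; first by rewrite mulr0 ltxx.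
  by rewrite pmulr_lgt0.
rewrite mxE sumr_ge0// => j _; rewrite !mxE -normCK exprn_ge0//.
Qed.

End PosDef.

Lemma hermposdefD M S : hermposdef M -> hermposdef S -> hermposdef (M + S).
Proof.
move=> [/hermsymP hM M0] [/hermsymP hS S0]; split.
  by apply/hermsymP; rewrite raddfD map_mxD hM hS.
by move=> v v0; rewrite mulmxDr mulmxDl mxE addr_gt0 ?M0 ?S0.
Qed.

(** Uniqueness of the positive definite square root.  With [B] the square root
    of [M] built on its eigenbasis, [S] commutes with [M = S^2], hence with
    [B], so [(S + B) (S - B) = S^2 - B^2 = 0], where [S + B] is invertible
    because it is positive definite. *)
Lemma hermposdef_sqrt_uniq M S :
  hermposdef M -> hermposdef S -> S *m S = M -> S = hfun M Num.sqrt.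
Proof.
move=> Mpd Spd SM; set B := hfun M _.
have Bpd : hermposdef B.
  by apply: hfun_gt0 => j; rewrite sqrtr_gt0 specval_gt0.
have BM : B *m B = M.
  rewrite hfunM -[RHS](hfun_id Mpd); apply: eq_hfun => j.
  by rewrite -expr2 sqr_sqrtr ?ltW ?specval_gt0.
have SB : S *m B = B *m S by apply: hfun_comm; rewrite // -SM mulmxA.
apply/eqP; rewrite -subr_eq0; apply/eqP.
apply: (can_inj (mulKmx (hermposdef_unit (hermposdefD Spd Bpd)))).
by rewrite mulmx0 mulmxBr !mulmxDl SM BM SB [M + _]addrC subrr.
Qed.

End HermitianCalculus.

(** * The scalar Newton iteration for the square root *)

Section ScalarNewton.
Variable R : realType.
Implicit Types (x : R) (k : nat).

(** The [k]-th Newton iterate for the square root of [x], started at [x]. *)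
Fixpoint newton_sqrt k x : R :=
  if k is k'.+1 then
    2^-1 * (newton_sqrt k' x + (newton_sqrt k' x)^-1 * x)
  else x.

Lemma newton_sqrt_gt0 k x : 0 < x -> 0 < newton_sqrt k x.
Proof.
move=> x0; elim: k => [//|k g0] /=.
by rewrite mulr_gt0 ?invr_gt0 ?addr_gt0 ?mulr_gt0 ?invr_gt0.
Qed.

Lemma newton_sqrt_err k x : 0 < x ->
  newton_sqrt k.+1 x - Num.sqrt x =
  (newton_sqrt k x - Num.sqrt x) ^+ 2 / (2 * newton_sqrt k x).
Proof.
move=> x0 /=; have g0 := newton_sqrt_gt0 k x0.
have s2 : Num.sqrt x ^+ 2 = x by rewrite sqr_sqrtr ?ltW.
set g := newton_sqrt k x in g0 *; set s := Num.sqrt x in s2 *.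
by rewrite -s2; field; rewrite ?gt_eqF.
Qed.

Lemma newton_sqrtS_ge k x : 0 < x -> Num.sqrt x <= newton_sqrt k.+1 x.
Proof.
move=> x0; rewrite -subr_ge0 newton_sqrt_err// divr_ge0 ?sqr_ge0//.
by rewrite mulr_ge0// ltW ?newton_sqrt_gt0.
Qed.

(** The term [x] of the minimum only serves [k = 0]: the starting point lies
    below the square root when [x < 1]. *)
Lemma newton_sqrt_ge k x : 0 < x ->
  Num.min x (Num.sqrt x) <= newton_sqrt k x.
Proof.
move=> x0; rewrite ge_min; case: k => [|k]; first by rewrite lexx.
by rewrite newton_sqrtS_ge ?orbT.
Qed.

Lemma newton_sqrt_halves k x : 0 < x ->
  newton_sqrt k.+2 x - Num.sqrt x <= 2^-1 * (newton_sqrt k.+1 x - Num.sqrt x).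
Proof.
move=> x0; rewrite newton_sqrt_err//.
have g0 := newton_sqrt_gt0 k.+1 x0; have gs := newton_sqrtS_ge k x0.
have s0 : 0 <= Num.sqrt x by exact: sqrtr_ge0.
set g := newton_sqrt k.+1 x in g0 gs *; set s := Num.sqrt x in gs s0 *.
rewrite ler_pdivrMr; last exact: mulr_gt0.
have -> : 2^-1 * (g - s) * (2 * g) = (g - s) * g by field.
by rewrite expr2 ler_wpM2l ?subr_ge0// lerBlDr lerDl.
Qed.

Lemma newton_sqrt_geometric k x : 0 < x ->
  newton_sqrt k.+1 x - Num.sqrt x <=
  2^-1 ^+ k * (newton_sqrt 1 x - Num.sqrt x).
Proof.
move=> x0; elim: k => [|k IHk]; first by rewrite expr0 mul1r.
apply: le_trans (newton_sqrt_halves k x0) _.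
by rewrite exprS -mulrA ler_pM2l.
Qed.

End ScalarNewton.

(** * Functions of T-positive definite tensors *)

Lemma interpolation (R : fieldType) (s : seq R) (f : R -> R) :
  exists q : {poly R}, {in s, forall x, q.[x] = f x}.
Proof.
elim: s => [|x s [q qf]]; first by exists 0.
pose r := \prod_(y <- s) ('X - y%:P).
have [xs|xs] := boolP (x \in s).
  by exists q => y; rewrite inE => /predU1P[->|]; exact: qf.
have r0 : r.[x] != 0 by rewrite -rootE root_prod_XsubC.
exists (q + ((f x - q.[x]) / r.[x]) *: r) => y.
rewrite inE hornerD hornerZ => /predU1P[->|ys].
  by rewrite divfK// addrC subrK.
have /rootP -> : root r y by rewrite root_prod_XsubC.
by rewrite mulr0 addr0 qf.
Qed.

Section TensorCalculus.
Variables (R : realType) (n p : nat).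
Implicit Types (A S X : tensor R n.+1 p.+1) (f g : R -> R).
Local Notation toC := (real_complex R).

(** The [j]-th eigenvalue of the [i]-th Fourier slice of [A], when this slice
    is Hermitian. *)
Definition tspecval A i j : R := specval (fslice A i) j.

(** Powers for the T-product. *)
Definition tpow A k : tensor R n.+1 p.+1 := iter k (tprod A) tid.

Lemma tfnorm_ge0 X : 0 <= tfnorm X.
Proof. exact: sqrtr_ge0. Qed.

(** The relation [X = f(A)]: each Fourier slice of [X] is [f] applied to that
    of [A].  It is meant for tensors [A] with Hermitian slices. *)
Definition is_tfun A f X := forall i, fslice X i = hfun (fslice A i) f.

Lemma is_tfun_uniq A f X Y : is_tfun A f X -> is_tfun A f Y -> X = Y.
Proof. by move=> fX fY; apply: fslice_inj => i; rewrite fX fY. Qed.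

Lemma is_tfunM A f g X Y : is_tfun A f X -> is_tfun A g Y ->
  is_tfun A (fun x => f x * g x) (tprod X Y).
Proof. by move=> fX gY i; rewrite fslice_tprod fX gY hfunM. Qed.

Lemma is_tfunD A f g X Y : is_tfun A f X -> is_tfun A g Y ->
  is_tfun A (fun x => f x + g x) (X + Y).
Proof. by move=> fX gY i; rewrite fsliceD fX gY hfunD. Qed.

Lemma is_tfunZ A f (c : R) X : is_tfun A f X ->
  is_tfun A (fun x => c * f x) (c *: X).
Proof. by move=> fX i; rewrite fsliceZ fX hfunZ. Qed.

Lemma eq_is_tfun A f g X :
  (forall i j, f (tspecval A i j) = g (tspecval A i j)) ->
  is_tfun A f X -> is_tfun A g X.
Proof. by move=> fg fX i; rewrite fX; apply: eq_hfun => j; exact: fg. Qed.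

Lemma is_tfunB A f g X Y : is_tfun A f X -> is_tfun A g Y ->
  is_tfun A (fun x => f x - g x) (X - Y).
Proof.
move=> fX gY; rewrite -scaleN1r.
apply: eq_is_tfun (is_tfunD fX (is_tfunZ (-1) gY)) => i j /=.
by rewrite mulN1r.
Qed.

Lemma is_tfun_tinv A f X Y : (forall i j, f (tspecval A i j) != 0) ->
  is_tfun A f X -> is_tfun A (fun x => (f x)^-1) Y -> is_tinv X Y.
Proof.
move=> f0 fX fY; apply/is_tinvE => i.
rewrite fX fY hfunM -(hfun_cst1 (fslice A i)); apply: eq_hfun => j.
by rewrite divff ?f0.
Qed.

Lemma is_tfun_tposdef A f X : (forall i j, 0 < f (tspecval A i j)) ->
  is_tfun A f X -> tposdef X.
Proof. by move=> f0 fX i; rewrite fX; apply: hfun_gt0 => j; exact: f0. Qed.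

(** The Frobenius norm of [f(A)], by Parseval's identity and the unitary
    invariance of the Frobenius norm of matrices. *)
Lemma is_tfun_tfnorm A f X : is_tfun A f X ->
  p.+1%:R * tfnorm X ^+ 2 = \sum_i \sum_j f (tspecval A i j) ^+ 2.
Proof.
move=> fX; apply: complexI; rewrite -parseval rmorph_sum.
by apply: eq_bigr => i _; rewrite fX hfun_sqrnorm.
Qed.

Lemma is_tfun_tfnorm_le A f g (c : R) X Y : 0 <= c ->
  is_tfun A f X -> is_tfun A g Y ->
  (forall i j, `|f (tspecval A i j)| <= c * `|g (tspecval A i j)|) ->
  tfnorm X <= c * tfnorm Y.
Proof.
move=> c0 fX gY fg.
rewrite -ler_sqr ?nnegrE ?mulr_ge0 ?tfnorm_ge0//.
rewrite -(ler_pM2l (ltr0Sn R p)) exprMn [leRHS]mulrCA.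
rewrite (is_tfun_tfnorm fX) (is_tfun_tfnorm gY).
rewrite mulr_sumr; apply: ler_sum => i _.
rewrite mulr_sumr; apply: ler_sum => j _.
rewrite -(real_normK (num_real (f _))) -(real_normK (num_real (g _))) -exprMn.
by rewrite ler_sqr ?nnegrE ?mulr_ge0.
Qed.

Lemma is_tfun_tfnorm_sqr_le A f g (c : R) X Y : 0 <= c ->
  is_tfun A f X -> is_tfun A g Y ->
  (forall i j, `|f (tspecval A i j)| <= c * g (tspecval A i j) ^+ 2) ->
  tfnorm X <= Num.sqrt p.+1%:R * c * tfnorm Y ^+ 2.
Proof.
move=> c0 fX gY fg.
rewrite -ler_sqr ?nnegrE ?mulr_ge0 ?sqrtr_ge0 ?sqr_ge0 ?tfnorm_ge0//.
rewrite 2!exprMn (sqr_sqrtr (ler0n R p.+1)) -(ler_pM2l (ltr0Sn R p)).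
rewrite [leRHS](_ : _ = c ^+ 2 * (p.+1%:R * tfnorm Y ^+ 2) ^+ 2); last by ring.
rewrite (is_tfun_tfnorm fX) (is_tfun_tfnorm gY).
pose e i j := g (tspecval A i j) ^+ 2.
have e0 i j : 0 <= e i j by exact: sqr_ge0.
apply: (@le_trans _ _ (c ^+ 2 * \sum_i \sum_j e i j ^+ 2)).
  rewrite mulr_sumr; apply: ler_sum => i _.
  rewrite mulr_sumr; apply: ler_sum => j _.
  rewrite -(real_normK (num_real (f _))) -exprMn.
  by rewrite ler_sqr ?nnegrE// (mulr_ge0 c0 (e0 i j)).
rewrite ler_wpM2l ?sqr_ge0//.
(* A sum of squares of nonnegative terms is at most the square of the sum. *)
rewrite !pair_big_dep /= expr2 mulr_suml; apply: ler_sum => -[i j] _ /=.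
rewrite expr2 ler_wpM2l// (bigD1 (i, j))//= lerDl.
by apply: sumr_ge0 => q _; exact: sqr_ge0.
Qed.

Section PosDef.
Variable A : tensor R n.+1 p.+1.
Hypothesis Apd : tposdef A.

Lemma tspecval_gt0 i j : 0 < tspecval A i j.
Proof. exact/specval_gt0/Apd. Qed.

Lemma is_tfun_id : is_tfun A id A.
Proof. by move=> i; rewrite (hfun_id (Apd i)). Qed.

Lemma is_tfun_tpow k : is_tfun A (fun x => x ^+ k) (tpow A k).
Proof.
elim: k => [|k IHk] /=.
  by move=> i; rewrite fslice_tid -(hfun_cst1 (fslice A i)).
apply: eq_is_tfun (is_tfunM is_tfun_id IHk) => i j.
by rewrite exprS.
Qed.

Lemma is_tfun_exists f : exists X, is_tfun A f X.
Proof.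
have [q qf] :=
  interpolation [seq tspecval A ij.1 ij.2 | ij : 'I_p.+1 * 'I_n.+1] f.
exists (\sum_(k < size q) q`_k *: tpow A k) => i.
rewrite fslice_sum.
under eq_bigr do rewrite (is_tfunZ _ (is_tfun_tpow _)).
rewrite -hfun_sum; apply: eq_hfun => j.
rewrite -horner_coef qf//; apply/mapP.
by exists (i, j); rewrite ?mem_enum.
Qed.

(** * Convergence of the iteration *)

Lemma newton_is_tfun k : is_tfun A (newton_sqrt k) (newton A k).
Proof.
elim: k => [|k IHk]; first exact: is_tfun_id.
have g0 i j : newton_sqrt k (tspecval A i j) != 0.
  by rewrite gt_eqF// newton_sqrt_gt0 ?tspecval_gt0.
have [Y fY] := is_tfun_exists (fun x => (newton_sqrt k x)^-1).
rewrite /= (tinv_eq (is_tfun_tinv g0 IHk fY)).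
exact/is_tfunZ/(is_tfunD IHk)/(is_tfunM fY)/is_tfun_id.
Qed.

Lemma newton_tposdef k : tposdef (newton A k).
Proof.
apply: is_tfun_tposdef (newton_is_tfun k) => i j.
by rewrite newton_sqrt_gt0 ?tspecval_gt0.
Qed.

Lemma is_tfun_sqrt S : is_tfun A Num.sqrt S -> is_principal_tsqrt A S.
Proof.
move=> fS; split.
- by apply: is_tfun_tposdef fS => i j; rewrite sqrtr_gt0 tspecval_gt0.
- apply: is_tfun_uniq is_tfun_id; apply: eq_is_tfun (is_tfunM fS fS) => i j.
  by rewrite -expr2 sqr_sqrtr// ltW ?tspecval_gt0.
- move=> S' Spd SA; apply: is_tfun_uniq fS => i.
  apply: hermposdef_sqrt_uniq => //.
  by rewrite -fslice_tprod SA.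
Qed.

Lemma tsqrt_is_tfun : is_tfun A Num.sqrt (tsqrt A).
Proof.
have [S fS] := is_tfun_exists Num.sqrt.
have SA := is_tfun_sqrt fS; have [_ _ Suniq] := SA.
have [Tpd TT _] : is_principal_tsqrt A (tsqrt A) := xgetPex 0 (ex_intro _ S SA).
by rewrite (Suniq _ Tpd TT).
Qed.

Lemma newton_err_is_tfun k :
  is_tfun A (fun x => newton_sqrt k x - Num.sqrt x) (newton A k - tsqrt A).
Proof. exact: is_tfunB (newton_is_tfun k) tsqrt_is_tfun. Qed.

Lemma tposdef_tinvertible : tinvertible A.
Proof.
have [Y fY] := is_tfun_exists (fun x => x^-1).
exists Y; apply: (is_tfun_tinv (f := id)) fY; last exact: is_tfun_id.
by move=> i j; rewrite gt_eqF ?tspecval_gt0.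
Qed.

Lemma tspecval_eigenvalue i j : tspecval A i j \in teigenvalues A.
Proof.
apply/allpairsPdep; exists i, (toC (tspecval A i j)).
by rewrite mem_enum specval_eigenvalue.
Qed.

Lemma teigenvalues_gt0 l : l \in teigenvalues A -> 0 < l.
Proof.
case/allpairsPdep => i [z [_ zi ->]].
by have := eigenvalues_gt0 (Apd i) zi; rewrite ltcE => /andP[].
Qed.

Lemma lambda_min_le i j : lambda_min A <= tspecval A i j.
Proof. by apply: ge_bigmin_seq => //; exact: tspecval_eigenvalue. Qed.

Lemma lambda_min_gt0 : 0 < lambda_min A.
Proof.
rewrite /lambda_min; have := tspecval_eigenvalue 0 0.
have := teigenvalues_gt0; case: (teigenvalues A) => [//|l s] s0 _.
rewrite big_seq; elim/big_ind: _ => //=; first by rewrite s0// mem_head.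
by move=> x y x0 y0; rewrite lt_min x0.
Qed.

Lemma newton_err_geometric k :
  tfnorm (newton A k.+1 - tsqrt A) <=
  2^-1 ^+ k * tfnorm (newton A 1 - tsqrt A).
Proof.
apply: is_tfun_tfnorm_le (newton_err_is_tfun _) (newton_err_is_tfun _) _.
  by rewrite exprn_ge0.
move=> i j; have x0 := tspecval_gt0 i j.
rewrite !ger0_norm ?subr_ge0; first exact: newton_sqrt_geometric.
  exact: newton_sqrtS_ge.
exact: newton_sqrtS_ge.
Qed.

Lemma newton_cvg : (fun k => tfnorm (newton A k - tsqrt A)) @ \oo --> (0 : R).
Proof.
rewrite -cvg_shiftS.
apply: (@squeeze_cvgr _ _ _ _ (fun=> 0)
  (fun k => 2^-1 ^+ k * tfnorm (newton A 1 - tsqrt A))); last 2 first.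
- exact: cvg_cst.
- rewrite -[X in _ --> X](mul0r (tfnorm (newton A 1 - tsqrt A))).
  apply: cvgMr_tmp; apply: cvg_expr.
  by rewrite ger0_norm ?invr_ge0// invf_lt1// ltr1n.
by apply: nearW => k; rewrite tfnorm_ge0 newton_err_geometric.
Qed.

Lemma newton_quadratic k
    (m := Num.min (lambda_min A) (Num.sqrt (lambda_min A))) :
  tfnorm (newton A k.+1 - tsqrt A) <=
  Num.sqrt p.+1%:R / (2 * m) * tfnorm (newton A k - tsqrt A) ^+ 2.
Proof.
have m0 : 0 < m by rewrite lt_min sqrtr_gt0 lambda_min_gt0.
apply: is_tfun_tfnorm_sqr_le (newton_err_is_tfun _) (newton_err_is_tfun _) _.
  by rewrite invr_ge0 mulr_ge0// ltW.
move=> i j; have x0 := tspecval_gt0 i j.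
rewrite newton_sqrt_err// ger0_norm; last first.
  by rewrite divr_ge0 ?sqr_ge0// mulr_ge0// ltW// newton_sqrt_gt0.
rewrite mulrC ler_wpM2r ?sqr_ge0//.
have mg : m <= newton_sqrt k (tspecval A i j).
  apply: le_trans (newton_sqrt_ge k x0).
  by rewrite le_min !ge_min ler_wsqrtr lambda_min_le ?orbT.
by rewrite lef_pV2 ?posrE ?ler_pM2l// mulr_gt0// newton_sqrt_gt0.
Qed.

End PosDef.
End TensorCalculus.

Theorem theorem2p3 (R : realType) (n p : nat) :
  exists C : R -> R -> R, forall A : tensor R n.+1 p.+1, tposdef A ->
    [/\ (forall k : nat, tposdef (newton A k) /\ tinvertible (newton A k)),
        is_principal_tsqrt A (tsqrt A),
        (fun k : nat => tfnorm (newton A k - tsqrt A)) @ \oo --> (0 : R),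
        0 < C (lambda_min A) (lambda_max A) &
        forall k : nat,
          tfnorm (newton A k.+1 - tsqrt A) <=
          C (lambda_min A) (lambda_max A) * tfnorm (newton A k - tsqrt A) ^+ 2].
Proof.
exists (fun a _ => Num.sqrt p.+1%:R / (2 * Num.min a (Num.sqrt a))) => A Apd.
split; [move=> k| | exact: newton_cvg| | exact: newton_quadratic].
- have Xpd := newton_tposdef Apd k.
  by split; [|exact: tposdef_tinvertible].
- exact/is_tfun_sqrt/tsqrt_is_tfun.
- by rewrite divr_gt0 ?mulr_gt0 ?lt_min ?sqrtr_gt0 ?lambda_min_gt0 ?ltr0Sn.
Qed.
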